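(* Let $k$ be an infinite field, let $R=k[x,y]$ be the standard graded polynomial ring in two variables, and let $d\geq 5$ be an integer. Let $I=(f_1,f_2,f_3)\subset R$ be a codimension $2$ ideal generated by three general forms $f_1,f_2,f_3$ of degree $d$. Then the Rees algebra $\mathcal{R}(I)=\bigoplus_{\ell\geq 0} I^{\ell}$ has depth $1$.
   Context: ''Three general forms of degree $d$'' means: there is a nonempty Zariski open subset $U$ (depending on $d$ and $k$) of the parameter space $k^{3(d+1)}$ of the coefficients of triples of forms of degree $d$ in $k[x,y]$ such that the assertion holds for every triple $(f_1,f_2,f_3)$ whose coefficient vector lies in $U$. The depth of $\mathcal{R}(I)$ is computed with respect to its graded maximal ideal $\mathcal{M}=(x,y,\bigoplus_{\ell\geq 1}I^{\ell})$. *)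

(* Defs.v *)
From HB Require Import structures.
From mathcomp Require Import all_boot all_order all_algebra.
From mathcomp Require Import boolp classical_sets cardinality.
From mathcomp Require Import mpoly.

Set Implicit Arguments.
Unset Strict Implicit.
Unset Printing Implicit Defensive.

Import GRing.Theory.
Local Open Scope ring_scope.

Section Ideals.
Variable A : comNzRingType.
Implicit Types (S : set A) (I P M : {pred A}) (s : seq A).

Definition ideal_gen S : {pred A} := fun x =>
  `[< exists n (c g : 'I_n -> A),
        (forall i, S (g i)) /\ x = \sum_(i < n) c i * g i >].

(* For l = 0 the only generator is the empty product, so I^0 = A. *)
Definition ideal_exp I (l : nat) : {pred A} :=
  ideal_gen [set x | exists a : 'I_l -> A,
    (forall i, a i \in I) /\ x = \prod_(i < l) a i]%classic.

(* [idealr_closed] includes properness: 1 \notin P. *)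
Definition prime_ideal P : Prop := idealr_closed P /\ prime_idealr_closed P.

Definition height_ge P (n : nat) : Prop :=
  exists Q : nat -> {pred A},
    [/\ forall i, (i <= n)%N -> prime_ideal (Q i),
        forall i, (i < n)%N ->
          {subset Q i <= Q i.+1} /\ exists2 x, x \in Q i.+1 & x \notin Q i
      & Q n =i P].

Definition height_eq P (n : nat) : Prop := height_ge P n /\ ~ height_ge P n.+1.

(* The codimension of I is the least height of a prime ideal containing I;  *)
(* the unit ideal has no codimension.                                       *)
Definition codim_eq I (n : nat) : Prop :=
  (exists P, [/\ prime_ideal P, {subset I <= P} & height_eq P n]) /\
  (forall P, prime_ideal P -> {subset I <= P} -> height_ge P n).

Definition regular_seq s : Prop :=
  (forall i, (i < size s)%N -> forall a,
     s`_i * a \in ideal_gen [set` take i s]%classic ->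
     a \in ideal_gen [set` take i s]%classic) /\
  1 \notin ideal_gen [set` s]%classic.

(* The depth of A with respect to M: the maximal length of an A-regular     *)
(* sequence contained in M.                                                 *)
Definition depth_eq M (n : nat) : Prop :=
  (exists s, [/\ regular_seq s, {subset s <= M} & size s = n]) /\
  (forall s, regular_seq s -> {subset s <= M} -> (size s <= n)%N).

End Ideals.

Section IdealTheory.
Variable A : comNzRingType.
Implicit Types (S : set A) (I : {pred A}).

Lemma ideal_genP S x : reflect (exists n (c g : 'I_n -> A),
    (forall i, S (g i)) /\ x = \sum_(i < n) c i * g i) (x \in ideal_gen S).
Proof. exact: asboolP. Qed.

Lemma ideal_gen0 S : 0 \in ideal_gen S.
Proof.
apply/ideal_genP; exists 0%N, (fun=> 0), (fun=> 0).
by split=> [[]//|]; rewrite big_ord0.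
Qed.

Lemma ideal_genD S x y :
  x \in ideal_gen S -> y \in ideal_gen S -> x + y \in ideal_gen S.
Proof.
move=> /ideal_genP[n [c [g [Sg ->]]]] /ideal_genP[m [c' [g' [Sg' ->]]]].
apply/ideal_genP; exists (n + m)%N.
exists (fun i => match split i with inl j => c j | inr j => c' j end).
exists (fun i => match split i with inl j => g j | inr j => g' j end).
split=> [i|]; first by case: (split i).
rewrite big_split_ord /=; congr (_ + _); apply: eq_bigr => i _.
  by rewrite (unsplitK (inl i)).
by rewrite (unsplitK (inr i)).
Qed.

Lemma ideal_genM S a x : x \in ideal_gen S -> a * x \in ideal_gen S.
Proof.
move=> /ideal_genP[n [c [g [Sg ->]]]]; apply/ideal_genP.
exists n, (fun i => a * c i), g; split=> //.
by rewrite mulr_sumr; apply: eq_bigr => i _; rewrite mulrA.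
Qed.

Lemma mem_ideal_gen S x : S x -> x \in ideal_gen S.
Proof.
move=> Sx; apply/ideal_genP; exists 1%N, (fun=> 1), (fun=> x).
by split=> //; rewrite big_ord1 mul1r.
Qed.

Lemma ideal_gen_sum S (T : Type) (r : seq T) (p : pred T) (F : T -> A) :
  (forall i, p i -> F i \in ideal_gen S) ->
  \sum_(i <- r | p i) F i \in ideal_gen S.
Proof.
move=> SF; apply: (big_ind (fun x => x \in ideal_gen S)) => //.
  exact: ideal_gen0.
exact: ideal_genD.
Qed.

Lemma ideal_expD I i j x y :
  x \in ideal_exp I i -> y \in ideal_exp I j -> x * y \in ideal_exp I (i + j).
Proof.
move=> /ideal_genP[n [c [g [Sg ->]]]] /ideal_genP[m [c' [g' [Sg' ->]]]].
rewrite mulr_suml; apply: ideal_gen_sum => u _.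
rewrite mulr_sumr; apply: ideal_gen_sum => v _.
rewrite mulrACA; apply/ideal_genM/mem_ideal_gen.
have [a [Ia ->]] := Sg u; have [b [Ib ->]] := Sg' v.
exists (fun t => match split t with inl p => a p | inr p => b p end).
split=> [t|]; first by case: (split t).
rewrite big_split_ord /=; congr (_ * _); apply: eq_bigr => t _.
  by rewrite (unsplitK (inl t)).
by rewrite (unsplitK (inr t)).
Qed.

Lemma ideal_exp0 I x : x \in ideal_exp I 0.
Proof.
rewrite -[x]mulr1; apply/ideal_genM/mem_ideal_gen.
by exists (fun=> 0); split=> [[]//|]; rewrite big_ord0.
Qed.

End IdealTheory.

Section Rees.
Variables (A : comNzRingType) (I : {pred A}).

(* The Rees algebra \bigoplus_l I^l, realized as the subring of A[t] of     *)
(* the polynomials whose coefficient of t^l lies in I^l.                    *)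
Definition rees_pred : {pred {poly A}} :=
  fun p : {poly A} => `[< forall l, p`_l \in ideal_exp I l >].

Lemma rees_predP (p : {poly A}) :
  reflect (forall l, p`_l \in ideal_exp I l) (p \in rees_pred).
Proof. exact: asboolP. Qed.

Lemma rees_subring_closed : subring_closed rees_pred.
Proof.
split=> [|p q /rees_predP Ip /rees_predP Iq|p q /rees_predP Ip /rees_predP Iq].
- apply/rees_predP => l; rewrite coef1; case: eqP => [->|_].
    exact: ideal_exp0.
  exact: ideal_gen0.
- apply/rees_predP => l; rewrite coefB -[q`_l]mul1r -mulNr.
  by apply: ideal_genD => //; apply: ideal_genM.
apply/rees_predP => l; rewrite coefM; apply: ideal_gen_sum => i _.
by have := ideal_expD (Ip i) (Iq (l - i)%N); rewrite subnKC ?leq_ord.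
Qed.

HB.instance Definition _ :=
  GRing.isSubringClosed.Build {poly A} rees_pred rees_subring_closed.

Record rees := Rees {rees_poly : {poly A}; _ : rees_poly \in rees_pred}.

HB.instance Definition _ := [isSub for rees_poly].
HB.instance Definition _ := [Choice of rees by <:].
HB.instance Definition _ := [SubChoice_isSubComNzRing of rees by <:].

End Rees.

Section Forms.
Variable k : fieldType.

(* The graded maximal ideal (x, y, \bigoplus_(l >= 1) I^l) of the Rees      *)
(* algebra of I; the elements of \bigoplus_(l >= 1) I^l are those whose     *)
(* component in degree 0 vanishes.                                          *)
Definition rees_max (I : {pred {mpoly k[2]}}) : {pred rees I} :=
  ideal_gen [set p : rees I |
    (exists i : 'I_2, rees_poly p = ('X_i)%:P) \/ (rees_poly p)`_0 = 0]%classic.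

(* The coefficients of x^(d-j) y^j in f_0, f_1, f_2, for 0 <= j <= d.       *)
Definition coef_vector (d : nat) (f : 'I_3 -> {mpoly k[2]}) :
    'rV[k]_(3 * d.+1) :=
  mxvec (\matrix_(i < 3, j < d.+1)
           (f i)@_[multinom [tuple (d - j)%N; nat_of_ord j]]).

(* Complements of common zero loci of sets of polynomials. *)
Definition zariski_open (N : nat) (U : set 'rV[k]_N) : Prop :=
  exists S : set {mpoly k[N]},
    U = [set v | exists2 g, S g & g.@[fun i => v ord0 i] != 0]%classic.

End Forms.

Arguments rees_max {k} I _.

(* Main.v *)
Require Import Defs.
From HB Require Import structures.
From mathcomp Require Import all_boot all_order all_algebra.
From mathcomp Require Import boolp classical_sets cardinality.
From mathcomp Require Import mpoly zify.

(* Let n = d^2. If I^n contains every form of degree d n + 1, then depth 1    *)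
(* follows: I misses some form of degree d + 1, because the x f_i, y f_i span *)
(* a space of dimension at most 6 < d + 2, and multiplying it by x, y and the *)
(* f_i as long as possible yields w = g t^l outside the Rees algebra with     *)
(* M w inside, that is, a socle element of H^1_M. The hypothesis on I^n says  *)
(* that a matrix polynomial in the coefficients has full rank, so it suffices *)
(* to give one triple satisfying it. With x = 1 and y = t, take 1,            *)
(* a = t^(d-1), b = t^d + t^2: then t^2 = b - t a, so k[t] is generated by 1  *)
(* and t over k[a, b], and b^i t^r, a^s b^(n-s), t b^n show that polynomials  *)
(* of degree n in a, b suffice up to degree d n + 1.                          *)

Set Implicit Arguments.
Unset Strict Implicit.
Unset Printing Implicit Defensive.

Import GRing.Theory.
Local Open Scope ring_scope.

(** Put R = k[x,y]. The element x is a regular sequence of length 1 in M ([rees_max_regular1]), so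
    the point is that M contains none of length 2. This follows from a homogeneous h t^l in R[t],
    outside the Rees algebra, that M multiplies into it ([regular_seq_size_le1]); by
    [rees_maxM_socle] it suffices to multiply by x, y and the f_i.

    Such an element exists because I omits a monomial of degree d+1, by a dimension count
    ([exists_monomial_notin_ideal]), while every form of degree above dn lies in I^n for n = d^2,
    hence in I^l for l <= n. Climbing from the monomial as long as possible ends at h
    ([exists_socle]).

    That I^n contains all forms of degree dn+1 is forced by the nonvanishing of one determinant in
    the coefficients ([generic_power_full]), which is 1 at an explicit triple
    ([linear_span_full]). *)

(** * Powers of an ideal *)

Section IdealPowers.
Variable A : comNzRingType.
Implicit Types (S : set A) (I J : {pred A}).

Lemma ideal_gen_min S (P : A -> Prop) : P 0 ->
  (forall x y, P x -> P y -> P (x + y)) -> (forall a x, S x -> P (a * x)) ->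
  forall x, x \in ideal_gen S -> P x.
Proof.
move=> P0 PD PM x /ideal_genP[n [c [g [Sg ->]]]].
by elim/big_ind: _ => // i _; apply: PM.
Qed.

Lemma ideal_exp_prod I l (a : 'I_l -> A) :
  (forall i, a i \in I) -> \prod_(i < l) a i \in ideal_exp I l.
Proof. by move=> Ia; apply: mem_ideal_gen; exists a. Qed.

Lemma ideal_exp1_gen S x : x \in ideal_exp (ideal_gen S) 1 -> x \in ideal_gen S.
Proof.
apply: (ideal_gen_min (P := fun z => z \in ideal_gen S)).
- exact: ideal_gen0.
- exact: ideal_genD.
by move=> a _ [b [Ib ->]]; rewrite big_ord1 ideal_genM.
Qed.

Lemma ideal_expS I l x : x \in ideal_exp I l.+1 -> x \in ideal_exp I l.
Proof.
apply: (ideal_gen_min (P := fun z => z \in ideal_exp I l)).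
- exact: ideal_gen0.
- exact: ideal_genD.
move=> a _ [b [Ib ->]]; rewrite big_ord_recl mulrA.
by apply/ideal_genM/ideal_exp_prod.
Qed.

Lemma ideal_exp_anti I l n x :
  (l <= n)%N -> x \in ideal_exp I n -> x \in ideal_exp I l.
Proof.
move=> /subnK<-; elim: (n - l)%N => // m IH.
by rewrite addSn => /ideal_expS.
Qed.

(** A product of j+1 elements of I has one factor to spend on g, which lands in I^(l+1); the other j
    factors contribute I^j. *)
Lemma mul_ideal_exp_gen S l j g x :
  (forall a, S a -> a * g \in ideal_exp (ideal_gen S) l.+1) ->
  x \in ideal_exp (ideal_gen S) j.+1 ->
  x * g \in ideal_exp (ideal_gen S) (j.+1 + l).
Proof.
set I := ideal_gen S => Sg; have Ig a : a \in I -> a * g \in ideal_exp I l.+1.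
  apply: (ideal_gen_min (P := fun a => a * g \in ideal_exp I l.+1)).
  - by rewrite mul0r ideal_gen0.
  - by move=> ? ? ? ?; rewrite mulrDl ideal_genD.
  - by move=> b y /Sg; rewrite -mulrA; apply: ideal_genM.
apply: (ideal_gen_min (P := fun x => x * g \in ideal_exp I (j.+1 + l))).
- by rewrite mul0r ideal_gen0.
- by move=> ? ? ? ?; rewrite mulrDl ideal_genD.
move=> a _ [b [Ib ->]]; rewrite big_ord_recl -mulrA; apply: ideal_genM.
rewrite mulrAC mulrC addSnnS; apply: ideal_expD; last exact: Ig.
exact: ideal_exp_prod.
Qed.

End IdealPowers.

(** * Depth of the Rees algebra *)

Section ReesPoly.
Variables (A : comNzRingType) (I : {pred A}).
Implicit Types p q : rees I.

Lemma rees_poly0 : rees_poly (0 : rees I) = 0.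
Proof. exact: (rmorph0 (val : rees I -> _)). Qed.

Lemma rees_poly1 : rees_poly (1 : rees I) = 1.
Proof. exact: (rmorph1 (val : rees I -> _)). Qed.

Lemma rees_polyD p q : rees_poly (p + q) = rees_poly p + rees_poly q.
Proof. exact: (rmorphD (val : rees I -> _)). Qed.

Lemma rees_polyM p q : rees_poly (p * q) = rees_poly p * rees_poly q.
Proof. exact: (rmorphM (val : rees I -> _)). Qed.

End ReesPoly.

(* Multiplication by w sends M into the Rees algebra, so for a, b in M the    *)
(* element a w is killed by b modulo a without being a multiple of a.         *)
Lemma regular_seq_size_le1 (A : idomainType) (I : {pred A})
    (M : {pred rees I}) (w : {poly A}) (s : seq (rees I)) :
  w \notin rees_pred I ->
  (forall p : rees I, p \in M -> rees_poly p * w \in rees_pred I) ->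
  regular_seq s -> {subset s <= M} -> (size s <= 1)%N.
Proof.
move=> wN Mw [reg sN1] sM; rewrite leqNgt; apply/negP => lt1s.
case: s lt1s reg sN1 sM => [|a [|b s]] // _ reg sN1 sM.
have aM : a \in M by apply: sM; rewrite mem_head.
have bM : b \in M by apply: sM; rewrite !inE eqxx orbT.
(* If a = 0, regularity applied to 1 puts 1 in the zero ideal, against properness. *)
have aN0 : rees_poly a != 0.
  apply/eqP => a0; move: sN1; apply/negP/negPn.
  have /= := reg 0%N erefl 1; rewrite mulr1 => reg0.
  have az : a = 0 by apply: val_inj; rewrite /= a0.
  have : 1 \in ideal_gen [set` [::] : seq (rees I)]%classic.
    by apply: reg0; rewrite az ideal_gen0.
  apply: (ideal_gen_min (P := fun z => z \in _)) => [||c x //].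
    exact: ideal_gen0.
  exact: ideal_genD.
pose z : rees I := Rees (Mw a aM).
have bz : b * z = Rees (Mw b bM) * a.
  by apply: val_inj; rewrite [LHS]rees_polyM [RHS]rees_polyM /= mulrA mulrAC.
have : z \in ideal_gen [set` [:: a]]%classic.
  apply: (reg 1%N erefl z); rewrite /= bz.
  by apply/ideal_genM/mem_ideal_gen; rewrite /= mem_head.
have zP : forall x : rees I, x \in ideal_gen [set` [:: a]]%classic ->
    exists c, x = c * a.
  apply: ideal_gen_min; first by exists 0; rewrite mul0r.
    by move=> _ _ [c ->] [e ->]; exists (c + e); rewrite mulrDl.
  by move=> c x /=; rewrite inE => /eqP->; exists c.
move=> /zP[c /(congr1 (@rees_poly A I))]; rewrite rees_polyM /= [in RHS]mulrC.
move=> /(mulfI aN0) wc; move: wN; rewrite wc => /negP[].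
exact: (valP c).
Qed.

Section ReesMax.
Variables (k : fieldType) (S : set {mpoly k[2]}).
Let I := ideal_gen S.

Lemma rees_maxM_socle l g :
  (forall i : 'I_2, 'X_i * g \in ideal_exp I l) ->
  (forall a, S a -> a * g \in ideal_exp I l.+1) ->
  forall p : rees I, p \in rees_max I ->
    rees_poly p * (g *: 'X^l) \in rees_pred I.
Proof.
move=> Xg Sg; apply: ideal_gen_min.
- by rewrite rees_poly0 mul0r rpred0.
- by move=> p q; rewrite rees_polyD mulrDl; apply: rpredD.
move=> a p Mp; rewrite rees_polyM /= -mulrA.
have aR : rees_poly a \in rees_pred I by case: a.
apply: rpredM => //; apply/rees_predP => j.
rewrite -scalerAr coefZ mulrC coefMXn; case: ltnP => [_|le_lj].
  by rewrite mul0r; apply: ideal_gen0.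
have pR : rees_poly p \in rees_pred I by case: (p).
case: Mp => [[i ->]|p0].
  rewrite coefC; case: eqP => [/eqP|_].
    by rewrite subn_eq0 => le_jl; have -> : j = l by apply/eqP; rewrite eqn_leq le_jl.
  by rewrite mul0r; apply: ideal_gen0.
(* The component of degree 0 vanishes; every higher one lies in some I^(i+1) and has a factor to
   spend on g. *)
have /rees_predP/(_ (j - l)%N) := pR; case E: (j - l)%N => [|i].
  by rewrite p0 mul0r => _; apply: ideal_gen0.
by move=> /(mul_ideal_exp_gen Sg); rewrite -E subnK.
Qed.

(** The sequence is x: R[t] is a domain, and a multiple of x has no constant term in its component
    of degree 0, so it is not 1. *)
Lemma rees_max_regular1 : exists s : seq (rees I),
  [/\ regular_seq s, {subset s <= rees_max I} & size s = 1%N].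
Proof.
have XR : ('X_0 : {mpoly k[2]})%:P \in rees_pred I.
  apply/rees_predP => -[|j]; first exact: ideal_exp0.
  by rewrite coefC; apply: ideal_gen0.
pose X : rees I := Rees XR.
exists [:: X]; split=> //; last first.
  by move=> p; rewrite inE => /eqP->; apply: mem_ideal_gen; left; exists 0.
split=> [[|//] _ a|].
  rewrite /= => Xa; suff -> : a = 0 by apply: ideal_gen0.
  have {Xa} : rees_poly (X * a) = 0.
    move: Xa; apply: (ideal_gen_min (P := fun z : rees I => rees_poly z = 0)).
    - exact: rees_poly0.
    - by move=> x y x0 y0; rewrite rees_polyD /= x0 y0 addr0.
    - by [].
  rewrite rees_polyM /= => /eqP; rewrite mulf_eq0 polyC_eq0.
  rewrite -msize_poly_eq0 msizeX /= => /eqP a0.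
  by apply: val_inj; rewrite /= a0.
apply/negP => X1.
have : (rees_poly (1 : rees I))`_0 @_0%MM = 0.
  move: X1; apply: (ideal_gen_min (P := fun z : rees I => (rees_poly z)`_0@_0%MM = 0)).
  - by rewrite rees_poly0 coef0 mcoeff0.
  - by move=> x y x0 y0; rewrite rees_polyD coefD mcoeffD /= x0 y0 addr0.
  move=> a x xX; have -> : x = X by apply/eqP; move: xX; rewrite /= inE.
  rewrite rees_polyM coefMC.
  by rewrite rmorphM /= mcoeffX mnm1_eq0 mulr0.
by rewrite rees_poly1 coef1 mcoeff1 eqxx => /eqP; rewrite oner_eq0.
Qed.

End ReesMax.

(** * Binary forms and dehomogenization *)

Section BinaryForms.
Variable k : fieldType.
Implicit Types h : {mpoly k[2]}.

Definition bimon (D l : nat) : 'X_{1..2} := [multinom [tuple (D - l)%N; l]].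

Lemma mdeg_bimon D l : (l <= D)%N -> mdeg (bimon D l) = D.
Proof. by move=> le_lD; rewrite mdegE big_ord_recl big_ord1 /= subnK. Qed.

Lemma bimonE D (m : 'X_{1..2}) : mdeg m = D -> m = bimon D (m ord_max).
Proof.
rewrite mdegE big_ord_recl big_ord1 => <-; apply/mnmP => i.
case: i => [[|[|//]]] lti; rewrite [RHS](tnth_nth 0%N) /=.
  have -> : Ordinal lti = ord0 by apply: val_inj.
  have -> : lift ord0 ord0 = ord_max :> 'I_2 by apply: val_inj.
  by rewrite addnK.
by congr (m _); apply: val_inj.
Qed.

Lemma bimon_le D (m : 'X_{1..2}) : mdeg m = D -> (m ord_max < D.+1)%N.
Proof. by move<-; rewrite ltnS mdegE big_ord_recr leq_addl. Qed.

Lemma binary_formE D h : h \is D.-homog ->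
  h = \sum_(l < D.+1) h@_(bimon D l) *: 'X_[bimon D l].
Proof.
move=> hD; apply/mpolyP => m; rewrite raddf_sum /=.
have [mD|mD] := eqVneq (mdeg m) D; last first.
  rewrite (dhomog_nemf_coeff hD mD) big1 // => l _.
  rewrite mcoeffZ mcoeffX; case: eqP => [E|]; last by rewrite mulr0.
  by move: mD; rewrite -E mdeg_bimon ?eqxx // -ltnS.
have le_mD := bimon_le mD.
rewrite (bigD1 (Ordinal le_mD)) //= -(bimonE mD).
rewrite mcoeffZ mcoeffX eqxx mulr1 big1 ?addr0 // => l.
rewrite -val_eqE /= => lN; rewrite mcoeffZ mcoeffX; case: eqP => [E|]; last first.
  by rewrite mulr0.
by move: lN; rewrite -E [_ ord_max](tnth_nth 0%N) /= eqxx.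
Qed.

(** Sets x = 1 and y = t, as variable i goes to t^i. *)
Definition dehomog : {mpoly k[2]} -> {poly k} :=
  mmap polyC (fun i : 'I_2 => 'X ^+ i).

HB.instance Definition _ := GRing.RMorphism.copy dehomog
  (mmap polyC (fun i : 'I_2 => 'X ^+ i : {poly k})).

Lemma dehomogX m : dehomog 'X_[m] = 'X^(m ord_max).
Proof.
rewrite /dehomog mmapX /mmap1 big_ord_recl big_ord1 /= expr0 expr1n mul1r.
by rewrite expr1; congr ('X ^+ (m _)); apply: val_inj.
Qed.

Lemma dehomogZ c h : dehomog (c *: h) = c *: dehomog h.
Proof. by rewrite /dehomog mmapZ mul_polyC. Qed.

Lemma dehomogE D h : h \is D.-homog ->
  dehomog h = \poly_(l < D.+1) h@_(bimon D l).
Proof.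
move=> hD; rewrite [in LHS](binary_formE hD) rmorph_sum poly_def.
by apply: eq_bigr => l _; rewrite /= dehomogZ dehomogX [_ ord_max](tnth_nth 0%N).
Qed.

Lemma dehomog_inj D h1 h2 : h1 \is D.-homog -> h2 \is D.-homog ->
  dehomog h1 = dehomog h2 -> h1 = h2.
Proof.
move=> h1D h2D; rewrite (dehomogE h1D) (dehomogE h2D) => E.
rewrite (binary_formE h1D) (binary_formE h2D); apply: eq_bigr => l _.
by have /(congr1 (fun p : {poly k} => p`_l)) := E; rewrite !coef_poly ltn_ord => ->.
Qed.

Lemma homog_ideal_ge (S : set {mpoly k[2]}) D E h :
  (forall m : 'X_{1..2}, mdeg m = D -> 'X_[m] \in ideal_gen S) ->
  (D <= E)%N -> h \is E.-homog -> h \in ideal_gen S.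
Proof.
move=> SD le_DE hE; rewrite (binary_formE hE); apply: ideal_gen_sum => l _.
rewrite -mul_mpolyC; apply: ideal_genM.
have le_lE : (l <= E)%N by rewrite -ltnS.
(* The divisor of degree D takes as many factors y as possible. *)
pose j := minn l D; have jl : (j <= l)%N by rewrite geq_minl.
have jD : (j <= D)%N by rewrite geq_minr.
have le1 : (D - j <= E - l)%N.
  rewrite /j /minn; case: ltnP => [_|_]; first exact: leq_sub2r.
  by rewrite subnn.
pose m1 : 'X_{1..2} := [multinom [tuple (E - l - (D - j))%N; (l - j)%N]].
have -> : bimon E l = (m1 + bimon D j)%MM.
  apply/mnmP => i; rewrite mnmDE !(mnm_nth 0%N).
  by case: i => [[|[|//]]] ? /=; rewrite subnK.
rewrite mpolyXD; apply/ideal_genM/SD; exact: mdeg_bimon.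
Qed.

(** As f is homogeneous, only the linear terms of c reach degree D+1; [a] holds their
    coefficients. *)
Lemma linear_part_mul D (f c : {mpoly k[2]}) : f \is D.-homog ->
  exists a : 'I_2 -> k, forall m, mdeg m = D.+1 ->
    (c * f)@_m = (\sum_(i < 2) a i *: ('X_i * f))@_m.
Proof.
move=> fD; elim/mpolyind: c => [|c m0 p _ _ [a IH]].
  by exists (fun=> 0) => m _; rewrite mul0r big1 // => i _; rewrite scale0r.
have [/eqP/mdeg1P[i /eqP m0E]|m0N] := eqVneq (mdeg m0) 1%N; last first.
  exists a => m mD; rewrite mulrDl mcoeffD IH // -scalerAl mcoeffZ.
  have XfD : 'X_[m0] * f \is (mdeg m0 + D).-homog.
    by apply: dhomogM => //; rewrite dhomogX.
  have mN : mdeg m != (mdeg m0 + D)%N by rewrite mD -add1n eqn_add2r eq_sym.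
  by rewrite (dhomog_nemf_coeff XfD mN) mulr0 add0r.
exists (fun j => a j + (j == i)%:R * c) => m mD.
rewrite mulrDl mcoeffD IH // m0E !raddf_sum /= (bigD1 i) //= [in RHS](bigD1 i) //=.
rewrite !eqxx mul1r -scalerAl !mcoeffZ mulrDl addrA [in LHS](addrC (c * _)); congr (_ + _).
by apply: eq_bigr => j /negbTE->; rewrite mul0r addr0.
Qed.

(* The 6-dimensional space spanned by the X_i f_j cannot fill the (d+2)-      *)
(* dimensional space of forms of degree d+1.                                  *)
Lemma exists_monomial_notin_ideal d (f : 'I_3 -> {mpoly k[2]}) : (5 <= d)%N ->
  (forall i, f i \is d.-homog) ->
  exists2 m : 'X_{1..2}, mdeg m = d.+1 & 'X_[m] \notin ideal_gen (range f).
Proof.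
move=> hd fd; apply: contrapT => H.
have XI (l : 'I_d.+2) : exists B : 'I_3 -> 'I_2 -> k, forall m, mdeg m = d.+1 ->
    ('X_[bimon d.+1 l])@_m = (\sum_j \sum_(i < 2) B j i *: ('X_i * f j))@_m.
  have : 'X_[bimon d.+1 l] \in ideal_gen (range f).
    rewrite -[_ \in _]negbK; apply/negP => N; apply: H.
    by exists (bimon d.+1 l) => //; rewrite mdeg_bimon -1?ltnS.
  move: {l H}'X_[_]; apply: ideal_gen_min.
  - exists (fun _ _ => 0) => m _; rewrite big1 // => j _.
    by rewrite big1 // => i _; rewrite scale0r.
  - move=> x y [B HB] [C HC]; exists (fun j i => B j i + C j i) => m mD.
    rewrite mcoeffD HB // HC // -mcoeffD -big_split /=; congr (_ @_ _).
    apply: eq_bigr => j _; rewrite -big_split; apply: eq_bigr => i _ /=.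
    by rewrite scalerDl.
  move=> c _ [j _ <-]; have [a ha] := linear_part_mul c (fd j).
  exists (fun j' i => (j' == j)%:R * a i) => m mD; rewrite ha //.
  rewrite [in RHS](bigD1 j) //= [X in (_ + X)@_ _]big1 ?addr0; last first.
    by move=> j' /negbTE->; rewrite big1 // => i _; rewrite mul0r scale0r.
  by congr (_ @_ _); apply: eq_bigr => i _; rewrite eqxx mul1r.
have {XI} [B HB] := choice XI.
(* [P] writes the monomials in terms of the X_i f_j and [Q] these in monomials, so the identity of
   size d+2 factors through k^6. *)
pose P := \matrix_(l < d.+2, e < #|{: 'I_3 * 'I_2}|)
  B l (enum_val e).1 (enum_val e).2.
pose Q := \matrix_(e < #|{: 'I_3 * 'I_2}|, l < d.+2)
  ('X_(enum_val e).2 * f (enum_val e).1)@_(bimon d.+1 l).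
have PQ : P *m Q = 1%:M.
  apply/matrixP => l l'; rewrite !mxE.
  have lb (i : 'I_d.+2) : (i <= d.+1)%N by rewrite -ltnS.
  transitivity (('X_[bimon d.+1 l] : {mpoly k[2]})@_(bimon d.+1 l')).
    rewrite HB ?mdeg_bimon // pair_big raddf_sum /=.
    rewrite (reindex (enum_val (A := {: 'I_3 * 'I_2}))) /=; last first.
      by apply: onW_bij; apply: enum_val_bij.
    by apply: eq_bigr => e _; rewrite !mxE mcoeffZ.
  rewrite mcoeffX; congr (_%:R); congr nat_of_bool.
  apply/eqP/eqP => [/(congr1 (fun m : 'X_{1..2} => m ord_max))|-> //].
  by rewrite /bimon !(mnm_nth 0%N) /= => /val_inj.
have := mulmx_max_rank P Q; rewrite PQ mxrank1 card_prod !card_ord.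
by rewrite leqNgt !ltnS hd.
Qed.

End BinaryForms.

(** * The explicit triple *)

Lemma poly_span_monic (k : fieldType) (V : {poly k} -> Prop) (N : nat) :
  V 0 -> (forall c u v, V u -> V v -> V (c *: u + v)) ->
  (forall j, (j < N)%N -> exists2 u : {poly k}, V u & u \is monic /\ size u = j.+1) ->
  forall u : {poly k}, (size u <= N)%N -> V u.
Proof.
move=> V0 VZD Vj; elim: N Vj => [|N IH] Vj u su.
  by move: su; rewrite leqn0 size_poly_eq0 => /eqP->.
have [v Vv [v1 sv]] := Vj N (ltnSn N).
rewrite -(subrK (u`_N *: v) u) addrC; apply: VZD => //.
apply: IH => [j lt_jN|]; first exact/Vj/ltnW.
apply/leq_sizeP => j; rewrite leq_eqVlt => /predU1P[<-|lt_Nj].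
  by move/monicP: v1; rewrite /lead_coef sv coefB coefZ /= => ->; rewrite mulr1 subrr.
rewrite coefB coefZ [u`_j]nth_default ?(leq_trans su) //.
by rewrite [v`_j]nth_default ?sv // mulr0 subrr.
Qed.

Lemma rmorph_mmap (n : nat) (R S T : comNzRingType) (f : {rmorphism R -> S})
    (g : {rmorphism S -> T}) (f' : {rmorphism R -> T}) (h : 'I_n -> S)
    (h' : 'I_n -> T) (p : {mpoly R[n]}) :
  g \o f =1 f' -> g \o h =1 h' -> g (mmap f h p) = mmap f' h' p.
Proof.
move=> gf gh; rewrite rmorph_sum; apply: eq_bigr => m _ /=.
rewrite rmorphM rmorph_prod; congr (_ * _); first exact: gf.
by apply: eq_bigr => i _; rewrite rmorphXn; congr (_ ^+ _); apply: gh.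
Qed.

Section Example.
Variables (k : fieldType) (d : nat).
Hypothesis d_ge3 : (3 <= d)%N.

(* The forms x^d, x y^(d-1), y^d + x^(d-2) y^2 at x = 1, y = t.               *)
Definition example_forms : 'I_3 -> {poly k} :=
  fun i => [:: 1; 'X^(d.-1); 'X^d + 'X^2]`_i.
Let F := example_forms.
Let a : {poly k} := 'X^(d.-1).
Let b : {poly k} := 'X^d + 'X^2.
Let E (p : {mpoly k[3]}) : {poly k} := mmap polyC F p.

(** At x = 1, y = t, this is x and y times the span of the n-fold products of the three forms. *)
Definition linear_span (n : nat) (u : {poly k}) : Prop :=
  exists p q : {mpoly k[3]},
    [/\ p \is n.-homog, q \is n.-homog & u = E p + 'X * E q].
Let V := linear_span.

Let E_X i : E 'X_i = F i.
Proof. by rewrite /E mmapX mmap1U. Qed.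

Let EM p q : E (p * q) = E p * E q.
Proof. exact: rmorphM. Qed.

Let homogX i : 'X_i \is [in k[3], 1.-homog].
Proof. by rewrite dhomogX /= mdeg1. Qed.

Let V_zd n c u v : V n u -> V n v -> V n (c *: u + v).
Proof.
move=> [p [q [hp hq ->]]] [p' [q' [hp' hq' ->]]].
exists (c *: p + p'), (c *: q + q').
split; [by apply: dhomogD => //; apply: dhomogZ.. |].
have EZ r : E (c *: r) = c *: E r by rewrite /E mmapZ mul_polyC.
rewrite /E !rmorphD -/(E _) -/(E _) /= -!/(E _) !EZ scalerDr mulrDr -scalerAr.
by rewrite addrACA.
Qed.

Let V_M n i u : V n u -> V n.+1 (F i * u).
Proof.
move=> [p [q [hp hq ->]]]; exists ('X_i * p), ('X_i * q).
rewrite -[n.+1]add1n; split; [by apply: dhomogM.. |].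
by rewrite !EM !E_X mulrDr mulrCA.
Qed.

Let V_Mexp n i j u : V n u -> V (j + n) (F i ^+ j * u).
Proof.
move=> Vu; elim: j => [|j IH]; first by rewrite expr0 mul1r.
by rewrite exprS -mulrA addSn; apply: V_M.
Qed.

(** The first form is 1, so multiplying by it raises the degree freely. *)
Let V_le m n u : (m <= n)%N -> V m u -> V n u.
Proof.
by move=> /subnK<- Vu; have := V_Mexp 0 (n - m) Vu; rewrite expr1n mul1r.
Qed.

Let V_1 : V 0 1.
Proof.
by exists 1, 0; rewrite dhomog1 dhomog0 /E rmorph1 rmorph0 mulr0 addr0.
Qed.

Let V_X0 : V 0 'X.
Proof.
by exists 0, 1; rewrite dhomog1 dhomog0 /E rmorph1 rmorph0 mulr1 add0r.
Qed.

(* t^2 = b - t a, so k[t] = k[a, b] + t k[a, b]. *)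
Let V_X n u : V n u -> V n.+1 ('X * u).
Proof.
(* t (p + t q) = b q + t (p - a q), with ['X_0], of value 1, equalizing the degrees. *)
move=> [p [q [hp hq ->]]]; exists ('X_(inord 2) * q), ('X_0 * p - 'X_1 * q).
rewrite -[n.+1]add1n; split; [by apply: dhomogM| |].
  by apply: rpredB; apply: dhomogM.
rewrite /E rmorphB /= -!/(E _) !EM !E_X /F /example_forms.
rewrite /= inordK //= mul1r mulrDr mulrA -expr2 mulrBr [RHS]addrC.
rewrite -addrA; congr (_ + _); rewrite mulrA -exprS prednK; last by case: d d_ge3.
by rewrite mulrDl addrA addNr add0r.
Qed.

Let V_Xn r : V r 'X^r.
Proof.
elim: r => [|r IH]; first by rewrite expr0.
by rewrite exprS; apply: V_X.
Qed.

Let b_monic : b \is monic /\ size b = d.+1.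
Proof.
have lt2 : (size ('X^2 : {poly k}) < size ('X^d : {poly k}))%N.
  by rewrite !size_polyXn.
split; last by rewrite size_polyDl // size_polyXn.
by rewrite monicE lead_coefDl // -monicE monicXn.
Qed.

Let monic_size (u v : {poly k}) i j : u \is monic /\ size u = i.+1 ->
  v \is monic /\ size v = j.+1 -> u * v \is monic /\ size (u * v) = (i + j).+1.
Proof.
move=> [u1 su] [v1 sv]; split; first by rewrite monicMl.
by rewrite size_monicM // -?size_poly_eq0 ?sv // su addSn addnS.
Qed.

Let bX_monic i : b ^+ i \is monic /\ size (b ^+ i) = (d * i).+1.
Proof.
elim: i => [|i IH]; first by rewrite expr0 muln0 monic1 size_poly1.
by rewrite exprS mulnS; apply: monic_size.
Qed.

Let Xn_monic i : ('X^i : {poly k}) \is monic /\ size ('X^i : {poly k}) = i.+1.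
Proof. by rewrite monicXn size_polyXn. Qed.

Let n := (d ^ 2)%N.

(** A monic element of each degree j <= dn+1 suffices: t b^n for j = dn+1; b^i t^r for j = di + r
    with r < d and i + r <= n; a^s b^(n-s) otherwise. *)
Lemma linear_span_full (u : {poly k}) : (size u <= (d * n).+2)%N -> linear_span n u.
Proof.
apply: poly_span_monic.
- exists 0, 0; rewrite !dhomog0; split=> //.
  by rewrite /E rmorph0 mulr0 addr0.
- exact: V_zd.
move=> j lt_j; have F2 : F (inord 2) = b.
  by rewrite /F /example_forms inordK.
have [->|jN] := eqVneq j (d * n).+1.
  exists (b ^+ n * 'X); last by rewrite -addn1; apply: monic_size (Xn_monic 1).
  by rewrite -F2; apply: (@V_le (n + 0)); [rewrite addn0 | apply: V_Mexp].
have {lt_j jN} le_j : (j <= d * n)%N by lia.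
have d0 : (0 < d)%N by lia.
have jE := divn_eq j d; have ltr := ltn_pmod j d0.
set i := (j %/ d)%N in jE *; set r := (j %% d)%N in jE ltr *.
have [le_ir|lt_ir] := leqP (i + r) n.
  exists (b ^+ i * 'X^r); last by rewrite jE mulnC; apply: monic_size.
  by apply: V_le le_ir _; rewrite -F2; apply: V_Mexp.
(* Here j = d n - s with s <= n, the degree of a^s b^(n-s). *)
pose s := (d * n - j)%N.
(* From n < i + r and r < d follows n - i < d, so s <= d (n - i) <= d^2 = n; hence the choice of
   n. *)
have le_sn : (s <= n)%N.
  have s_le : (s <= d * (n - i))%N by rewrite mulnBr leq_sub2l // jE mulnC leq_addr.
  have : (d * (n - i) <= d * d)%N by rewrite leq_mul2l; lia.
  by apply: leq_trans.
exists (a ^+ s * (b ^+ (n - s) * 1)).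
  have F1 : F 1 = a by [].
  rewrite -F1 -F2; apply: (@V_le (s + (n - s + 0))); first by rewrite addn0 subnKC.
  by do 2!apply: V_Mexp.
have -> : j = (d.-1 * s + d * (n - s))%N.
  have E1 : (d * s + d * (n - s) = d * n)%N by rewrite -mulnDr subnKC.
  have E2 : (d * s = d.-1 * s + s)%N by rewrite -{1}(prednK d0) mulSn addnC.
  by have E3 : (s + j = d * n)%N := subnK le_j; lia.
rewrite mulr1 -exprM; exact: monic_size.
Qed.

End Example.

(** * From the explicit triple to general forms *)

Section GenericForms.
Variables (k : fieldType) (d : nat).
Hypothesis d_ge3 : (3 <= d)%N.
Let N := (3 * d.+1)%N.
Let n := (d ^ 2)%N.
Let D := (d * n).+1.

Definition generic_forms (i : 'I_3) : {poly {mpoly k[N]}} :=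
  \sum_(j < d.+1) 'X_(mxvec_index i j) *: 'X^j.

Definition specialize (v : 'rV[k]_N) : {poly {mpoly k[N]}} -> {poly k} :=
  map_poly (meval (fun i => v ord0 i)).

HB.instance Definition _ v := GRing.RMorphism.copy (specialize v)
  (map_poly (meval (fun i => v ord0 i))).

Lemma specialize_generic (v : 'rV[k]_N) (A : 'M[k]_(3, d.+1)) i : v = mxvec A ->
  specialize v (generic_forms i) = \sum_(j < d.+1) A i j *: 'X^j.
Proof.
move=> ->; rewrite rmorph_sum; apply: eq_bigr => j _ /=.
by rewrite /specialize map_polyZ /= map_polyXn mevalXU mxvecE.
Qed.

(** The ring [K] varies so that one pair can be evaluated both at generic and at actual
    coefficients. *)
Definition span_expr (K : comNzRingType) (h : {rmorphism k -> K})
    (f : 'I_3 -> {poly K}) (pq : {mpoly k[3]} * {mpoly k[3]}) : {poly K} :=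
  mmap (polyC \o h) f pq.1 + 'X * mmap (polyC \o h) f pq.2.

Lemma specialize_span_expr v f pq :
  (forall i, specialize v (generic_forms i) = f i) ->
  specialize v (span_expr (@mpolyC N k) generic_forms pq) = span_expr idfun f pq.
Proof.
move=> vf; rewrite rmorphD rmorphM /=; congr (_ + _ * _).
- by apply: rmorph_mmap => // c; rewrite /= /specialize map_polyC /= mevalC.
- by rewrite /specialize map_polyX.
by apply: rmorph_mmap => // c; rewrite /= /specialize map_polyC /= mevalC.
Qed.

Lemma homog_mem_ideal_exp (f : 'I_3 -> {mpoly k[2]}) l (p : {mpoly k[3]}) :
  (forall i, f i \is d.-homog) -> p \is l.-homog ->
  mmap (@mpolyC 2 k) f p \in ideal_exp (ideal_gen (range f)) l /\
  mmap (@mpolyC 2 k) f p \is (d * l).-homog.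
Proof.
move=> fd pl; pose I := ideal_gen (range f).
have Xm (m : 'X_{1..3}) : mmap1 f m \in ideal_exp I (mdeg m) /\
    mmap1 f m \is (d * mdeg m).-homog.
  rewrite mdegE /mmap1; elim/big_rec2: _ => [|i y x _ [xI xd]].
    by rewrite muln0 dhomog1 ideal_exp0.
  have fI : f i ^+ m i \in ideal_exp I (m i).
    rewrite -[X in f i ^+ X]card_ord -prodr_const; apply: ideal_exp_prod => _.
    by apply: mem_ideal_gen; exists i.
  by rewrite ideal_expD // mulnDr dhomogM // dhomogMn.
split; rewrite /mmap big_seq.
  apply: ideal_gen_sum => m /(dhomog_mf pl) <-; apply: ideal_genM.
  by have [] := Xm m.
apply: rpred_sum => m /(dhomog_mf pl) <-; rewrite mul_mpolyC.
by apply: dhomogZ; have [] := Xm m.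
Qed.

(** Where the determinant is nonzero, the D+1 forms x p_j(f) + y q_j(f), which lie in I^n, span all
    forms of degree D; at the explicit triple the matrix is the identity. *)
Lemma generic_power_full : exists g : {mpoly k[N]},
  (exists v : 'rV[k]_N, g.@[fun i => v ord0 i] != 0) /\
  forall f : 'I_3 -> {mpoly k[2]}, (forall i, f i \is d.-homog) ->
    g.@[fun i => coef_vector d f ord0 i] != 0 ->
    forall h, h \is D.-homog -> h \in ideal_exp (ideal_gen (range f)) n.
Proof.
have Xj (j : 'I_D.+1) : exists pq : {mpoly k[3]} * {mpoly k[3]},
    [/\ pq.1 \is n.-homog, pq.2 \is n.-homog
      & 'X^j = span_expr idfun (@example_forms k d) pq].
  have [|p [q [hp hq E]]] := @linear_span_full k d d_ge3 'X^j.
    by rewrite size_polyXn.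
  by exists (p, q).
have {Xj} [pq Hpq] := choice Xj.
(* The pairs found for the explicit triple stay fixed while the coefficients become generic, so the
   matrix is square. *)
pose W j := span_expr (@mpolyC N k) generic_forms (pq j).
pose M : 'M[{mpoly k[N]}]_D.+1 := \matrix_(j, l) (W j)`_l.
exists (\det M).
have detE v f : (forall i, specialize v (generic_forms i) = f i) ->
    (\det M).@[fun i => v ord0 i] =
      \det (\matrix_(j < D.+1, l < D.+1) (span_expr idfun f (pq j))`_l).
  move=> vf; rewrite -det_map_mx; congr (\det _); apply/matrixP => j l.
  by rewrite !mxE -(specialize_span_expr _ vf) /specialize coef_map.
split.
  exists (mxvec (\matrix_(i < 3, j < d.+1) (@example_forms k d i)`_j)).
  rewrite (detE _ (@example_forms k d)) => [|i]; last first.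
    rewrite (specialize_generic i (erefl _)).
    under eq_bigr do rewrite mxE.
    rewrite -poly_def; apply/polyP => l; rewrite coef_poly; case: ltnP => // le_dl.
    apply/esym/nth_default/(leq_trans _ le_dl).
    rewrite /example_forms; case: i => [[|[|[|//]]]] lti /=.
    - by rewrite size_poly1.
    - by rewrite size_polyXn; lia.
    rewrite (leq_trans (size_polyD _ _)) // geq_max !size_polyXn; lia.
  suff -> : \matrix_(j < D.+1, l < D.+1)
      (span_expr idfun (@example_forms k d) (pq j))`_l = 1%:M.
    by rewrite det1 oner_eq0.
  apply/matrixP => j l; rewrite !mxE; have [_ _ <-] := Hpq j.
  by rewrite coefXn eq_sym.
move=> f fd; pose v := coef_vector d f; pose f' i := dehomog (f i).
have vf i : specialize v (generic_forms i) = f' i.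
  rewrite (specialize_generic i (erefl _)) /f' (dehomogE (fd i)) poly_def.
  by apply: eq_bigr => j _; rewrite mxE.
rewrite (detE _ _ vf); set Mf := \matrix_(_, _) _ => detN0 h hD.
pose w j := 'X_0 * mmap (@mpolyC 2 k) f (pq j).1
            + 'X_1 * mmap (@mpolyC 2 k) f (pq j).2.
have wD j : w j \is D.-homog.
  have [p1 p2 _] := Hpq j; have X1 i : 'X_i \is [in k[2], 1.-homog].
    by rewrite dhomogX /= mdeg1.
  have [_ q1] := homog_mem_ideal_exp fd p1; have [_ q2] := homog_mem_ideal_exp fd p2.
  by rewrite /w /D -[(d * n).+1]add1n; apply: dhomogD; apply: dhomogM.
have wI j : w j \in ideal_exp (ideal_gen (range f)) n.
  have [p1 p2 _] := Hpq j; apply: ideal_genD; apply: ideal_genM.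
    by have [] := homog_mem_ideal_exp fd p1.
  by have [] := homog_mem_ideal_exp fd p2.
have dw j : dehomog (w j) = span_expr idfun f' (pq j).
  rewrite /w rmorphD !rmorphM /= !dehomogX !mnm1E /= expr0 mul1r.
  have dE p : dehomog (mmap (@mpolyC 2 k) f p) = mmap (polyC \o idfun) f' p.
    by apply: rmorph_mmap => // c; rewrite /= /dehomog mmapC.
  by rewrite !dE.
pose r : 'rV[k]_D.+1 := \row_l (dehomog h)`_l.
pose c := r *m invmx Mf.
have -> : h = \sum_j c ord0 j *: w j.
  have sumD : \sum_j c ord0 j *: w j \is D.-homog.
    by apply: rpred_sum => j _; apply: dhomogZ.
  apply: (dehomog_inj hD sumD).
  have cM : c *m Mf = r by rewrite mulmxKV // unitmxE unitfE.
  have sz h' : h' \is D.-homog -> (size (dehomog h') <= D.+1)%N.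
    by move=> /dehomogE->; apply: size_poly.
  apply/polyP => l; have [lt_l|le_l] := ltnP l D.+1; last first.
    by rewrite !nth_default // (leq_trans _ le_l) // sz.
  have /rowP/(_ (Ordinal lt_l)) := cM; rewrite [LHS]mxE [RHS]mxE /= => <-.
  rewrite rmorph_sum coef_sum; apply: eq_bigr => j _ /=.
  by rewrite dehomogZ coefZ dw [Mf _ _]mxE.
by apply: ideal_gen_sum => j _; rewrite -mul_mpolyC; apply: ideal_genM.
Qed.

End GenericForms.

(** * The socle element and the depth *)

(* Multiplying g_0 by x, y (staying in I^l) or by some f_i (passing to        *)
(* I^(l+1)) while remaining outside the power of I must stop: forms of degree *)
(* above d n lie in I^n.                                                      *)
Lemma exists_socle (k : fieldType) (d n l0 D0 : nat) (f : 'I_3 -> {mpoly k[2]})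
    (g0 : {mpoly k[2]}) (I := ideal_gen (range f)) :
  (0 < d)%N -> (forall i, f i \is d.-homog) ->
  (forall h, h \is (d * n).+1.-homog -> h \in ideal_exp I n) ->
  (l0 <= n)%N -> (d * l0 < D0)%N -> g0 \is D0.-homog ->
  g0 \notin ideal_exp I l0 ->
  exists l g, [/\ g \notin ideal_exp I l,
    forall i : 'I_2, 'X_i * g \in ideal_exp I l
    & forall i, f i * g \in ideal_exp I l.+1].
Proof.
move=> d0 fd In; have {}In l D h : (l <= n)%N -> (d * n < D)%N ->
    h \is D.-homog -> h \in ideal_exp I l.
  move=> le_ln lt_D hD; apply: ideal_exp_anti le_ln _.
  apply: (homog_ideal_ge _ lt_D hD) => m mD; apply: In.
  by rewrite dhomogX /= mD.
(* Each multiplication raises the degree D and keeps d l < D; while D <= dn this gives l < n, so l+1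
   is still allowed. *)
have [c] := ubnP ((d * n).+1 - D0).
elim: c l0 D0 g0 => // c IH l D g lt_c le_ln lt_D gD gN.
have [/(In l D g le_ln)/(_ gD) gI|le_D] := ltnP (d * n) D.
  by rewrite gI in gN.
have lt_ln : (l < n)%N by rewrite -(ltn_pmul2l d0); apply: leq_trans lt_D le_D.
have [[i XN]|Xg] := pselect (exists i : 'I_2, 'X_i * g \notin ideal_exp I l).
  apply: (IH l D.+1 ('X_i * g)) => //; [lia|exact: ltnW|].
  by rewrite -[D.+1]add1n dhomogM // dhomogX /= mdeg1.
have [[i fN]|fg] := pselect (exists i, f i * g \notin ideal_exp I l.+1).
  apply: (IH l.+1 (d + D)%N (f i * g)) => //; [lia|by rewrite mulnS ltn_add2l|].
  exact: dhomogM.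
exists l, g; split=> // i; rewrite -[_ \in _]negbK; apply/negP => N.
  by apply: Xg; exists i.
by apply: fg; exists i.
Qed.

Theorem theorem6p1 (k : fieldType) (d : nat)
    (k_infinite : infinite_set [set: k]%classic) (hd : (5 <= d)%N) :
  exists U : set 'rV[k]_(3 * d.+1),
    [/\ zariski_open U, (U !=set0)%classic &
      forall f : 'I_3 -> {mpoly k[2]},
        (forall i, f i \is d.-homog) ->
        U (coef_vector d f) ->
        let I := ideal_gen (range f) in
        codim_eq I 2 ->
        depth_eq (rees_max I) 1].
Proof.
have [|g [[v gv] gP]] := @generic_power_full k d; first exact: ltn_trans hd.
exists [set v : 'rV[k]_(3 * d.+1) | g.@[fun i => v ord0 i] != 0]%classic.
split; [|by exists v|].
  exists [set g]%classic; apply/seteqP; split=> u /=.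
    by move=> gu; exists g.
  by move=> [_ ->].
move=> f fd Uf I _; split; first exact: rees_max_regular1.
have [m mD mN] := exists_monomial_notin_ideal hd fd.
have d0 : (0 < d)%N by apply: leq_trans hd.
have [l [h [hN Xh fh]]] : exists l h, [/\ h \notin ideal_exp I l,
    forall i : 'I_2, 'X_i * h \in ideal_exp I l
    & forall i, f i * h \in ideal_exp I l.+1].
  (* The climb starts at m t, of degree d+1 > d * 1. *)
  apply: (exists_socle (l0 := 1) (D0 := d.+1) (g0 := 'X_[m]) d0 fd (gP f fd Uf)).
  - by rewrite expn_gt0 d0.
  - by rewrite muln1.
  - by rewrite dhomogX /= mD.
  by apply: contra mN; apply: ideal_exp1_gen.
move=> s; apply: (regular_seq_size_le1 (w := h *: 'X^l)).
  apply: contra hN => /rees_predP/(_ l).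
  by rewrite coefZ coefXn eqxx mulr1.
by apply: rees_maxM_socle => // _ [i _ <-].
Qed.
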